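(* Let $n\ge2$ and consider data points $(x_i,y_i)\in\mathbb{R}^2$, $1\le i\le n$. (a) The regression lines in the $Y$, $X$ and $D$ minimization methods are invariant under translations. (b) If all the points $(x_i,y_i)$ lie on a line that is not vertical, then the regression line for $Y$ minimization is this line. If all the points lie on a line that is not horizontal, then the regression line for $X$ minimization is this line. If all the points lie on a line, then the regression line for $D$ minimization is this line. (c) Only the regression line for $D$ minimization is invariant under rotation. That is, the regression line for $D$ minimization is invariant under rotations, while those for $Y$ minimization and $X$ minimization are not.
   Context: For $x=(x_1,\dots,x_n),\,y=(y_1,\dots,y_n)\in\mathbb{R}^n$: $\overline{x}=\frac1n\sum_{i=1}^n x_i$, $\operatorname{cov}(x,y)=\frac1n\sum_{i=1}^n x_iy_i-\overline{x}\,\overline{y}$, $\operatorname{var}(x)=\operatorname{cov}(x,x)$. Regression lines. $Y$ minimization (used when $\operatorname{var}(x)\ne0$): the line $y=mx+b$ where $(m,b)\in\mathbb{R}^2$ is the unique minimizer of $\frac1n\sum_{i=1}^n(mx_i+b-y_i)^2$. $X$ minimization (used when $\operatorname{var}(y)\neq0$): the line $x=\mu y+\beta$ where $(\mu,\beta)\in\mathbb{R}^2$ is the unique minimizer of $\frac1n\sum_{i=1}^n(\mu y_i+\beta-x_i)^2$. $D$ minimization (no condition on the data): the line $x\sin\theta-y\cos\theta=c$ where $(\theta,c)$, with $-\pi/2<\theta\le\pi/2$ and $c\in\mathbb{R}$, minimizes $\frac1n\sum_{i=1}^n(x_i\sin\theta-y_i\cos\theta-c)^2$. The minimum occurs at $c=\overline{x}\sin\theta-\overline{y}\cos\theta$;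 if $\operatorname{var}(x)=\operatorname{var}(y)$ and $\operatorname{cov}(x,y)=0$, all values of $\theta$ (with this $c$) give the same minimum, and otherwise the minimizer is unique. Invariance. The regression line is invariant under translations if, when all points are translated the same way, $(x_i,y_i)\mapsto(x_i+u,y_i+v)$ with $u,v\in\mathbb{R}$, the regression line translates the same way as well. The regression line is invariant under rotations if, when all points are rotated by the same angle $\phi$, $(x_i,y_i)\mapsto(x_i\cos\phi-y_i\sin\phi,\ x_i\sin\phi+y_i\cos\phi)$, the regression line undergoes the same rotation. *)

(* Defs.v *)
From HB Require Import structures.
From mathcomp Require Import all_boot all_order all_algebra.
From mathcomp Require Import all_classical all_reals all_analysis.

Set Implicit Arguments.
Unset Strict Implicit.
Unset Printing Implicit Defensive.

Import Order.TTheory GRing.Theory Num.Theory.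

Local Open Scope classical_set_scope.
Local Open Scope ring_scope.

Section Statistics.
Variables (R : realType) (n : nat).
Implicit Types x y : 'rV[R]_n.

Definition mean x : R := n%:R^-1 * \sum_(i < n) x ord0 i.

Definition cov x y : R :=
  n%:R^-1 * (\sum_(i < n) x ord0 i * y ord0 i) - mean x * mean y.

Definition var x : R := cov x x.

End Statistics.

Definition minimizer (R : realType) (T : Type) (D : set T) (f : T -> R)
  (p : T) : Prop := D p /\ forall q, D q -> f p <= f q.

(* Lines are subsets of the plane, so that the three ways of writing
   equations of regression lines can be compared. *)
Section Lines.
Variable R : realType.
Implicit Types L : set (R * R).

Definition is_line L : Prop := exists a b c : R,
  (a, b) <> (0, 0) /\ L = [set p | a * p.1 + b * p.2 = c].

Definition vertical L : Prop := exists c : R, L = [set p | p.1 = c].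

Definition horizontal L : Prop := exists c : R, L = [set p | p.2 = c].

Definition translation (u v : R) (p : R * R) : R * R := (p.1 + u, p.2 + v).

Definition rotation (phi : R) (p : R * R) : R * R :=
  (p.1 * cos phi - p.2 * sin phi, p.1 * sin phi + p.2 * cos phi).

End Lines.

Section Regression.
Variables (R : realType) (n : nat).
Implicit Types (x y : 'rV[R]_n) (L : set (R * R)).

Definition points_on x y L : Prop := forall i, L (x ord0 i, y ord0 i).

Definition Y_error x y (p : R * R) : R :=
  n%:R^-1 * \sum_(i < n) (p.1 * x ord0 i + p.2 - y ord0 i) ^+ 2.

Definition X_error x y (p : R * R) : R :=
  n%:R^-1 * \sum_(i < n) (p.1 * y ord0 i + p.2 - x ord0 i) ^+ 2.

Definition D_error x y (p : R * R) : R :=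
  n%:R^-1 *
  \sum_(i < n) (x ord0 i * sin p.1 - y ord0 i * cos p.1 - p.2) ^+ 2.

Definition D_domain : set (R * R) := [set p | - (pi / 2) < p.1 <= pi / 2].

Definition Y_line x y L : Prop := var x != 0 /\
  exists m b : R, unique (minimizer setT (Y_error x y)) (m, b) /\
    L = [set p | p.2 = m * p.1 + b].

Definition X_line x y L : Prop := var y != 0 /\
  exists mu beta : R, unique (minimizer setT (X_error x y)) (mu, beta) /\
    L = [set p | p.1 = mu * p.2 + beta].

(* When var x = var y and cov x y = 0 the minimizer is not unique, and each
   of the minimizing lines counts as a regression line. *)
Definition D_line x y L : Prop :=
  exists theta c : R, minimizer D_domain (D_error x y) (theta, c) /\
    L = [set p | p.1 * sin theta - p.2 * cos theta = c].

(* [M x y L] reads: L is a regression line of the data (x, y). *)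
Definition method := 'rV[R]_n -> 'rV[R]_n -> set (R * R) -> Prop.

Definition translation_invariant (M : method) : Prop :=
  forall x y L (u v : R), M x y L ->
    M (x + const_mx u) (y + const_mx v) (translation u v @` L).

Definition rotate_x (phi : R) x y : 'rV[R]_n := cos phi *: x - sin phi *: y.

Definition rotate_y (phi : R) x y : 'rV[R]_n := sin phi *: x + cos phi *: y.

(* In particular the rotated data must have a regression line. *)
Definition rotation_invariant (M : method) : Prop :=
  forall x y L (phi : R), M x y L ->
    M (rotate_x phi x y) (rotate_y phi x y) (rotation phi @` L).

(* The comparison is only made when the original and the rotated data both
   have a regression line. *)
Definition rotation_invariant_where_defined (M : method) : Prop :=
  forall x y L L' (phi : R), M x y L ->
    M (rotate_x phi x y) (rotate_y phi x y) L' -> L' = rotation phi @` L.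

End Regression.

(* Main.v *)
Require Import Defs.
From HB Require Import structures.
From mathcomp Require Import all_boot all_order all_algebra.
From mathcomp Require Import all_classical all_reals all_analysis.
From mathcomp Require Import ring lra.

(** Each method is reduced to a description that no longer mentions its
   parametrization of lines.

   For the vertical method, completing the square twice writes the error of
   [y = m x + b] as
     [var x * (m - k) ^+ 2 + (m * mean x + b - mean y) ^+ 2 + const],
   with [k = cov x y / var x].  Since [var x > 0], the regression line is the
   line of slope [k] through the centroid ([Y_lineP]).  Translations preserve
   variances and covariances and move the centroid along, and data with
   [y = m x + b] have [cov x y = m * var x]: this gives (a) and (b).  A quarter
   turn replaces the slope [cov x y / var x] by [- cov x y / var y], whereas
   turning the line gives [- var x / cov x y]; they agree only when
   [cov x y ^+ 2 = var x * var y], which three non-collinear points violate.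
   With only two distinct points the failure is of another kind: the points
   (1, 0) and (0, 0) are sent to points on a vertical line.

   The horizontal method is the vertical one with the coordinates exchanged
   ([X_line_swap]), and the exchange turns a rotation into the inverse
   rotation, so nothing has to be done twice.

   For the D method, every pair (a, b) with [a ^+ 2 + b ^+ 2 = 1] is up to sign
   (sin theta, cos theta) for an angle of the half-open domain, and the error
   does not see the sign.  Hence one may minimize over all unit normals
   ([D_lineP]), a set which rotations permute; invariance is then a change of
   variables.  Collinear data have minimal error 0, so that the minimizing
   lines are the lines containing all the points, and two such lines coincide
   unless both variances and the covariance vanish. *)

Set Implicit Arguments.
Unset Strict Implicit.
Unset Printing Implicit Defensive.

Import Order.TTheory GRing.Theory Num.Theory.

Local Open Scope classical_set_scope.
Local Open Scope ring_scope.

(** * Covariance as a translation-invariant bilinear form *)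

Section Covariance.
Variables (R : realType) (n : nat).
Implicit Types (x y z r : 'rV[R]_n) (u : R).

Lemma meanD x y : mean (x + y) = mean x + mean y.
Proof.
rewrite /mean -mulrDr -big_split; congr (_ * _).
by apply: eq_bigr => i _; rewrite mxE.
Qed.

Lemma meanZ u x : mean (u *: x) = u * mean x.
Proof.
rewrite /mean mulrCA [u * _]mulr_sumr; congr (_ * _).
by apply: eq_bigr => i _; rewrite mxE.
Qed.

Lemma covC x y : cov x y = cov y x.
Proof.
rewrite /cov [mean x * _]mulrC; congr (_ * _ - _).
by apply: eq_bigr => i _; rewrite mulrC.
Qed.

Lemma covDl x y z : cov (x + y) z = cov x z + cov y z.
Proof.
rewrite /cov meanD; under eq_bigr do rewrite mxE mulrDl.
by rewrite big_split /=; ring.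
Qed.

Lemma covZl u x y : cov (u *: x) y = u * cov x y.
Proof.
rewrite /cov meanZ; under eq_bigr do rewrite mxE -mulrA.
by rewrite -mulr_sumr; ring.
Qed.

Lemma covDr x y z : cov x (y + z) = cov x y + cov x z.
Proof. by rewrite covC covDl !(covC x). Qed.

Lemma covZr u x y : cov x (u *: y) = u * cov x y.
Proof. by rewrite covC covZl covC. Qed.

Lemma mean_square_eq r :
  n%:R^-1 * \sum_(i < n) r ord0 i ^+ 2 = var r + mean r ^+ 2.
Proof. by rewrite /var /cov -expr2 subrK. Qed.

Hypothesis n_gt0 : (0 < n)%N.

Let n_neq0 : n%:R != 0 :> R.
Proof. by rewrite pnatr_eq0 -lt0n. Qed.

Lemma mean_const u : mean (const_mx u : 'rV[R]_n) = u.
Proof.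
rewrite /mean; under eq_bigr do rewrite mxE.
by rewrite sumr_const card_ord -[u *+ n]mulr_natl mulKf.
Qed.

Lemma cov_constl u x : cov (const_mx u) x = 0.
Proof.
rewrite /cov mean_const; under eq_bigr do rewrite mxE.
by rewrite -mulr_sumr /mean; ring.
Qed.

Lemma cov_constr x u : cov x (const_mx u) = 0.
Proof. by rewrite covC cov_constl. Qed.

(** The variance is the mean square of the centred data. *)
Lemma var_ge0 x : 0 <= var x.
Proof.
set r := x - const_mx (mean x).
have -> : var x = n%:R^-1 * \sum_(i < n) r ord0 i ^+ 2.
  rewrite mean_square_eq /r -scaleN1r scalemx_const meanD mean_const.
  by rewrite /var covDl !covDr !(cov_constl, cov_constr); ring.
by rewrite mulr_ge0 ?invr_ge0// sumr_ge0// => i _; exact: sqr_ge0.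
Qed.

Lemma cov_delta (i j : 'I_n) :
  cov (delta_mx ord0 i : 'rV[R]_n) (delta_mx ord0 j) =
    n%:R^-1 * (i == j)%:R - n%:R^-1 ^+ 2.
Proof.
have sum_delta (k : 'I_n) (f : 'I_n -> R) :
    \sum_(l < n) (delta_mx ord0 k : 'rV[R]_n) ord0 l * f l = f k.
  rewrite (bigD1 k)//= big1 => [|l /negPf lk].
    by rewrite !mxE !eqxx /=; ring.
  by rewrite mxE lk/= mul0r.
have mean_delta k : mean (delta_mx ord0 k : 'rV[R]_n) = n%:R^-1.
  rewrite /mean -[RHS]mulr1 -(sum_delta k (fun=> 1)); congr (_ * _).
  by apply: eq_bigr => l _; rewrite mulr1.
by rewrite /cov sum_delta !mean_delta mxE eqxx.
Qed.

End Covariance.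

(** * Images of lines *)

Section Images.
Variable R : realType.
Implicit Types (L : set (R * R)) (u v phi : R).

Definition swap (p : R * R) : R * R := (p.2, p.1).

Lemma swap_preimageK L : swap @^-1` (swap @^-1` L) = L.
Proof. by apply/seteqP; split=> -[p q]. Qed.

Lemma image_translation L u v :
  translation u v @` L = translation (- u) (- v) @^-1` L.
Proof.
apply/seteqP; split=> [_ [[p q] Lpq <-]|[p q] Lpq] /=.
  by rewrite /translation /= !addrK.
by exists (translation (- u) (- v) (p, q)) => //; rewrite /translation /= !subrK.
Qed.

Lemma rotationK phi : cancel (rotation phi) (rotation (- phi)).
Proof.
move=> [p q]; rewrite /rotation /= cosN sinN; have := cos2Dsin2 phi => h.
congr (_, _).
  by transitivity (p * (cos phi ^+ 2 + sin phi ^+ 2)); [ring|rewrite h mulr1].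
by transitivity (q * (cos phi ^+ 2 + sin phi ^+ 2)); [ring|rewrite h mulr1].
Qed.

Lemma image_rotation L phi : rotation phi @` L = rotation (- phi) @^-1` L.
Proof.
apply/seteqP; split=> [_ [p Lp <-]|p Lp] /=; first by rewrite rotationK.
by exists (rotation (- phi) p) => //; rewrite -{1}[phi]opprK rotationK.
Qed.

(** Conjugating a rotation by a reflection gives the inverse rotation. *)
Lemma swap_image_rotation L phi :
  swap @^-1` (rotation phi @` L) = rotation (- phi) @` (swap @^-1` L).
Proof.
rewrite !image_rotation opprK; apply/seteqP.
have e p : swap (rotation phi p) = rotation (- phi) (swap p).
  by rewrite /swap /rotation /= cosN sinN; congr (_, _); ring.
by split=> p /=; rewrite e.
Qed.

End Images.

(** * Vertical and horizontal least squares *)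

Section LeastSquares.
Variables (R : realType) (n : nat).
Hypothesis n_gt0 : (0 < n)%N.
Implicit Types (x y : 'rV[R]_n) (L : set (R * R)).

(** Separating the mean square of the residual into its variance and its
   squared mean leaves a quadratic polynomial in [m] alone, which is completed
   to a square. *)
Lemma Y_error_square x y m b : var x != 0 ->
  Y_error x y (m, b) =
    var x * (m - cov x y / var x) ^+ 2 + (m * mean x + b - mean y) ^+ 2
    + (var y - cov x y ^+ 2 / var x).
Proof.
move=> vx; set r := m *: x + const_mx b + (- 1) *: y.
have -> : Y_error x y (m, b) = n%:R^-1 * \sum_(i < n) r ord0 i ^+ 2.
  by congr (_ * _); apply: eq_bigr => i _; rewrite !mxE mulN1r.
rewrite mean_square_eq /r !meanD !meanZ mean_const//.
rewrite /var !(covDl, covDr, covZl, covZr) !(cov_constl, cov_constr)//.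
rewrite (covC y x) -!/(var _).
by field.
Qed.

(** The regression line is the line of slope [cov x y / var x] through the
   centroid. *)
Lemma Y_lineP x y L :
  Y_line x y L <-> var x != 0 /\
    L = [set p | p.2 - mean y = cov x y / var x * (p.1 - mean x)].
Proof.
suff uniq_min : var x != 0 ->
    unique (minimizer setT (Y_error x y))
      (cov x y / var x, mean y - cov x y / var x * mean x).
  split=> [[vx [m [b [[mb _] ->]]]]|[vx ->]]; split=> //.
    have [_ /(_ _ mb)[<- <-]] := uniq_min vx.
    apply/seteqP; split=> p /= => [->|e]; first by ring.
    by rewrite -[LHS](subrK (mean y)) e; ring.
  exists (cov x y / var x), (mean y - cov x y / var x * mean x).
  split; first exact: uniq_min.
  apply/seteqP; split=> p /= => [e|->]; last by ring.
  by rewrite -[LHS](subrK (mean y)) e; ring.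
move=> vx.
have vx_gt0 : 0 < var x by rewrite lt_def vx var_ge0.
set k := cov x y / var x.
have at_min : k * mean x + (mean y - k * mean x) - mean y = 0 by ring.
split; first split=> // -[m b] _.
  rewrite !Y_error_square// -/k at_min subrr lerD2r expr0n /= mulr0 addr0.
  by rewrite addr_ge0 ?sqr_ge0// mulr_ge0 ?sqr_ge0// ltW.
move=> [m b] [_ /(_ (k, mean y - k * mean x) I)].
rewrite !Y_error_square// -/k at_min subrr lerD2r expr0n /= mulr0 addr0 => le0.
have sq1 : 0 <= var x * (m - k) ^+ 2 by rewrite mulr_ge0 ?sqr_ge0// ltW.
have sq2 : 0 <= (m * mean x + b - mean y) ^+ 2 by exact: sqr_ge0.
have /eqP : var x * (m - k) ^+ 2 = 0 by lra.
rewrite mulf_eq0 (negPf vx) sqrf_eq0 subr_eq0 /= => /eqP mk.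
have /eqP : (m * mean x + b - mean y) ^+ 2 = 0 by lra.
by rewrite sqrf_eq0 mk => /eqP e; congr (_, _); lra.
Qed.

Lemma X_line_swap x y L : X_line x y L <-> Y_line y x (@swap R @^-1` L).
Proof.
split=> -[vy [m [b [mb eL]]]]; split=> //; exists m, b; split=> //.
  by rewrite eL; apply/seteqP; split=> -[].
by rewrite -[L]swap_preimageK eL; apply/seteqP; split=> -[].
Qed.

Lemma Y_line_translation : translation_invariant (@Y_line R n).
Proof.
move=> x y L u v /Y_lineP[vx ->]; apply/Y_lineP.
rewrite /var !(covDl, covDr) !(cov_constl, cov_constr)// !addr0 -/(var x).
split=> //; rewrite image_translation !meanD !mean_const//.
by apply/seteqP; split=> p /= e; lra.
Qed.

Lemma X_line_translation : translation_invariant (@X_line R n).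
Proof.
move=> x y L u v /X_line_swap /Y_line_translation h; apply/X_line_swap.
have -> // : @swap R @^-1` (translation u v @` L) =
  translation v u @` (@swap R @^-1` L).
by rewrite !image_translation; apply/seteqP; split.
Qed.

(** Data on the graph [y = m x + b] satisfy [cov x y = m * var x] and
   [mean y = m * mean x + b]. *)
Lemma Y_line_collinear x y L : is_line L -> points_on x y L ->
  ~ vertical L -> var x != 0 -> Y_line x y L.
Proof.
move=> [a [b [c [ab eL]]]] xyL nvert vx; apply/Y_lineP; split=> //.
have b0 : b != 0.
  apply: contra_notN nvert => /eqP b0; move: ab; rewrite eL b0 => ab.
  have a0 : a != 0 by apply: contra_notN ab => /eqP ->.
  exists (c / a); apply/seteqP; split=> p /= => [<-|->]; field => //.
have h i : a * x ord0 i + b * y ord0 i = c by have := xyL i; rewrite eL.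
have ey : y = (- a / b) *: x + const_mx (c / b).
  by apply/rowP => i; rewrite !mxE -(h i); field.
rewrite ey covDr covZr cov_constr// addr0 meanD meanZ mean_const//.
rewrite -/(var x) mulfK// eL.
apply/seteqP; split=> p /= e; first by rewrite -e; field.
have -> : p.2 = - a / b * p.1 + c / b by lra.
by field.
Qed.

Lemma X_line_collinear x y L : is_line L -> points_on x y L ->
  ~ horizontal L -> var y != 0 -> X_line x y L.
Proof.
move=> [a [b [c [ab eL]]]] xyL nhor vy.
apply/X_line_swap/Y_line_collinear => //.
  exists b, a, c; split; first by move=> [b0 a0]; apply: ab; rewrite a0 b0.
  by rewrite eL; apply/seteqP; split=> p /=; rewrite addrC.
move=> [d ed]; apply: nhor; exists d.
by rewrite -[L]swap_preimageK ed; apply/seteqP; split.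
Qed.

Lemma Y_line_unique x y L L' : Y_line x y L -> Y_line x y L' -> L' = L.
Proof. by move=> /Y_lineP[_ ->] /Y_lineP[_ ->]. Qed.

Lemma X_line_unique x y L L' : X_line x y L -> X_line x y L' -> L' = L.
Proof.
move=> /X_line_swap h /X_line_swap /(Y_line_unique h) e.
by rewrite -[L]swap_preimageK -e swap_preimageK.
Qed.

(** The squared correlation of the data is 1 as soon as the quarter turn takes
   the regression line to the regression line of the turned data: the two
   slopes have product [-1]. *)
Lemma quarter_turn_cov x y :
  rotation_invariant_where_defined (@Y_line R n) ->
  var x != 0 -> var y != 0 -> cov x y ^+ 2 = var x * var y.
Proof.
move=> inv vx vy.
have ex : rotate_x (pi / 2) x y = (- 1) *: y.
  by rewrite /rotate_x cos_pihalf sin_pihalf scale0r scale1r sub0r scaleN1r.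
have ey : rotate_y (pi / 2) x y = x.
  by rewrite /rotate_y cos_pihalf sin_pihalf scale0r scale1r addr0.
have vNy : var ((- 1) *: y) = var y by rewrite /var covZl covZr; ring.
have /(inv _ _ _ _ (pi / 2)) : Y_line x y
    [set p | p.2 - mean y = cov x y / var x * (p.1 - mean x)] by apply/Y_lineP.
rewrite ex ey => /(_ [set p | p.2 - mean x =
  cov ((- 1) *: y) x / var ((- 1) *: y) * (p.1 - mean ((- 1) *: y))]).
rewrite image_rotation vNy meanZ covZl (covC y) => turned.
have /turned e : Y_line ((- 1) *: y) x [set p | p.2 - mean x =
    - 1 * cov x y / var y * (p.1 - - 1 * mean y)].
  by apply/Y_lineP; rewrite vNy meanZ covZl (covC y).
(* The turned line contains the turned centroid translated by a vector of
   abscissa [var y]; turning back, it must lie on the original line. *)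
have : [set p : R * R | p.2 - mean x =
    - 1 * cov x y / var y * (p.1 - - 1 * mean y)]
    (- mean y + var y, mean x - cov x y) by move=> /=; field.
rewrite e /= /rotation /= cosN sinN cos_pihalf sin_pihalf => h.
have {h} : - var y = cov x y / var x * - cov x y by lra.
by move=> h; rewrite -[var y]opprK h; field.
Qed.

Lemma X_to_Y_rotation_invariant :
  rotation_invariant (@X_line R n) -> rotation_invariant (@Y_line R n).
Proof.
move=> inv x y L phi Yl.
have /(inv _ _ _ (- phi)) /X_line_swap : X_line y x (@swap R @^-1` L).
  by apply/X_line_swap; rewrite swap_preimageK.
rewrite swap_image_rotation opprK swap_preimageK /rotate_x /rotate_y cosN sinN.
by rewrite !scaleNr opprK [- _ + _]addrC [_ *: y + _]addrC.
Qed.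

Lemma X_to_Y_rotation_invariant_where_defined :
  rotation_invariant_where_defined (@X_line R n) ->
  rotation_invariant_where_defined (@Y_line R n).
Proof.
move=> inv x y L L' phi Yl Yl'.
have Xl : X_line y x (@swap R @^-1` L).
  by apply/X_line_swap; rewrite swap_preimageK.
have Xl' : X_line (rotate_x (- phi) y x) (rotate_y (- phi) y x)
    (@swap R @^-1` L').
  apply/X_line_swap; rewrite swap_preimageK; move: Yl'.
  rewrite /rotate_x /rotate_y cosN sinN !scaleNr opprK.
  by rewrite [- _ + _]addrC [cos phi *: y + _]addrC.
rewrite -[L']swap_preimageK (inv _ _ _ _ _ Xl Xl').
by rewrite swap_image_rotation opprK swap_preimageK.
Qed.

End LeastSquares.

(** * Failure of rotation invariance *)

Section NonInvariance.
Variables (R : realType) (n : nat).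

(** The points (1, 0) and (0, 0), turned by a right angle, lie on a vertical
   line. *)
Lemma Y_line_not_rotation_invariant : (2 <= n)%N ->
  ~ rotation_invariant (@Y_line R n).
Proof.
move=> n2 inv; have n0 : (0 < n)%N by exact: ltnW.
pose x : 'rV[R]_n := delta_mx ord0 (Ordinal n0).
have n_neq0 : n%:R != 0 :> R by rewrite pnatr_eq0 -lt0n.
have vx : var x != 0.
  rewrite /var cov_delta// eqxx mulr1 expr2 -{1}[n%:R^-1]mulr1 -mulrBr.
  rewrite mulf_neq0 ?invr_neq0// subr_eq0 eq_sym invr_eq1.
  by rewrite pnatr_eq1 neq_ltn n2 orbT.
have /(inv _ _ _ (pi / 2)) [] : Y_line x 0 [set p | p.2 - mean (0 : 'rV[R]_n) =
    cov x 0 / var x * (p.1 - mean x)] by apply/Y_lineP.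
rewrite /rotate_x cos_pihalf scale0r scaler0 subrr -(scale0r 0).
by rewrite /var covZl mul0r eqxx.
Qed.

(** The points (1, 0), (0, 1) and (0, 0), the last one repeated, have
   [var x = var y = (n - 1) / n ^ 2] and [cov x y = - 1 / n ^ 2], which
   [quarter_turn_cov] allows for [n = 2] only. *)
Lemma Y_line_not_rotation_invariant_where_defined : (3 <= n)%N ->
  ~ rotation_invariant_where_defined (@Y_line R n).
Proof.
move=> n3 inv; have n1 : (1 < n)%N by exact: ltnW.
have n0 : (0 < n)%N by exact: ltnW.
pose x : 'rV[R]_n := delta_mx ord0 (Ordinal n0).
pose y : 'rV[R]_n := delta_mx ord0 (Ordinal n1).
have n_ge3 : 3 <= n%:R :> R by rewrite ler_nat.
have t_gt0 : 0 < n%:R^-1 :> R by rewrite invr_gt0; lra.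
have nt : n%:R * n%:R^-1 = 1 :> R by rewrite mulfV//; lra.
have cxy : cov x y = - n%:R^-1 ^+ 2 by rewrite cov_delta// mulr0 sub0r.
have vx : var x = n%:R^-1 - n%:R^-1 ^+ 2 by rewrite /var cov_delta// eqxx mulr1.
have vy : var y = n%:R^-1 - n%:R^-1 ^+ 2 by rewrite /var cov_delta// eqxx mulr1.
move: (n%:R^-1) t_gt0 nt cxy vx vy => t t_gt0 nt cxy vx vy.
have t_small : 3 * t <= 1 by rewrite -[leRHS]nt ler_pM2r.
have v_gt0 : 0 < t - t ^+ 2 by nra.
have /(_ _ _)/eqP := quarter_turn_cov n0 inv (x := x) (y := y).
rewrite cxy vx vy lt0r_neq0// => /(_ isT isT).
rewrite sqrrN -expr2 eqf_sqr => /orP[] /eqP; nra.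
Qed.

End NonInvariance.

(** * Orthogonal least squares *)

Section Orthogonal.
Variables (R : realType) (n : nat).
Implicit Types (x y : 'rV[R]_n) (L : set (R * R)) (a b c phi : R).

(** [D_error] with the unit vector [(sin theta, cos theta)] made a variable. *)
Definition normal_error x y a b c : R :=
  n%:R^-1 * \sum_(i < n) (x ord0 i * a - y ord0 i * b - c) ^+ 2.

Lemma normal_error_sign x y a b c e : e ^+ 2 = 1 ->
  normal_error x y (e * a) (e * b) (e * c) = normal_error x y a b c.
Proof.
move=> e1; congr (_ * _); apply: eq_bigr => i _.
rewrite -[RHS]mul1r -e1; ring.
Qed.

Lemma normal_error_ge0 x y a b c : 0 <= normal_error x y a b c.
Proof.
by rewrite mulr_ge0 ?invr_ge0// sumr_ge0// => i _; exact: sqr_ge0.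
Qed.

Lemma normal_error_eq0 x y a b c : (0 < n)%N ->
  (normal_error x y a b c == 0) <->
  (forall i, x ord0 i * a - y ord0 i * b = c).
Proof.
move=> n0; rewrite mulf_eq0 invr_eq0 pnatr_eq0 -leqn0 leqNgt n0 /=.
split=> [/eqP/psumr_eq0P h i|h].
  apply/eqP; rewrite -subr_eq0 -sqrf_eq0 h// => j _; exact: sqr_ge0.
by rewrite big1// => i _; rewrite h subrr expr0n.
Qed.

(** An angle [theta] with [- (pi / 2) < theta <= pi / 2] is a unit vector up
   to sign. *)
Lemma unit_vector_angle a b : a ^+ 2 + b ^+ 2 = 1 ->
  exists theta e : R, [/\ - (pi / 2) < theta <= pi / 2, e ^+ 2 = 1,
    sin theta = e * a & cos theta = e * b].
Proof.
move=> ab; have pi0 := pi_gt0 R.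
have [b0|b0] := eqVneq b 0.
  exists (pi / 2), a; rewrite sin_pihalf cos_pihalf b0 mulr0 -expr2.
  move: ab; rewrite b0 expr0n addr0 => ->; split=> //.
  by rewrite lexx andbT; lra.
have e1 : Num.sg b ^+ 2 = 1 by rewrite sqr_sg b0.
have b2 : 0 < b ^+ 2 by rewrite exprn_even_gt0.
have ea : (Num.sg b * a) ^+ 2 = a ^+ 2 by rewrite exprMn e1 mul1r.
have /ltr_normlP[ltN1 lt1] : `|Num.sg b * a| < 1.
  by rewrite -(@expr_lt1 _ 2)// real_normK ?num_real// ea; lra.
exists (asin (Num.sg b * a)), (Num.sg b); split=> //.
- by rewrite asin_gtNpi2 ?asin_lepi2//; apply/andP; split; lra.
- by rewrite asinK// in_itv /=; apply/andP; split; lra.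
- rewrite cos_asin; last by apply/andP; split; lra.
  have -> : 1 - (Num.sg b * a) ^+ 2 = b ^+ 2 by rewrite ea; lra.
  by rewrite sqrtr_sqr normrEsg.
Qed.

Lemma D_lineP x y L : D_line x y L <->
  exists a b c, [/\ a ^+ 2 + b ^+ 2 = 1,
    forall a' b' c', a' ^+ 2 + b' ^+ 2 = 1 ->
      normal_error x y a b c <= normal_error x y a' b' c' &
    L = [set p | p.1 * a - p.2 * b = c]].
Proof.
split=> [[theta [c [[_ minc] eL]]]|[a [b [c [ab minc eL]]]]].
  exists (sin theta), (cos theta), c; split=> //.
    by rewrite addrC cos2Dsin2.
  move=> a b d ab; have [t [e [dom_t e1 st ct]]] := unit_vector_angle ab.
  have := minc (t, e * d) dom_t.
  by rewrite -(normal_error_sign _ _ a b d e1) -st -ct.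
have [t [e [dom_t e1 st ct]]] := unit_vector_angle ab.
exists t, (e * c); split; first split=> //.
  move=> [s d] _; rewrite /D_error /= st ct.
  rewrite -/(normal_error x y (e * a) (e * b) (e * c)) normal_error_sign//.
  by apply: minc; rewrite addrC cos2Dsin2.
rewrite eL st ct; apply/seteqP; split=> p /= h; first by rewrite -h; ring.
transitivity (e ^+ 2 * (p.1 * a - p.2 * b)); first by rewrite e1 mul1r.
transitivity (e * (p.1 * (e * a) - p.2 * (e * b))); first by ring.
by rewrite h mulrA -expr2 e1 mul1r.
Qed.

Lemma D_line_translation : translation_invariant (@D_line R n).
Proof.
move=> x y L u v /D_lineP[a [b [c [ab minc ->]]]]; apply/D_lineP.
have E a' b' c' : normal_error (x + const_mx u) (y + const_mx v) a' b' c' =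
    normal_error x y a' b' (c' - (u * a' - v * b')).
  by congr (_ * _); apply: eq_bigr => i _; rewrite !mxE; ring.
exists a, b, (c + (u * a - v * b)); split=> //.
  by move=> a' b' c' ab'; rewrite !E addrK; exact: minc.
by rewrite image_translation; apply/seteqP; split=> p /= h; lra.
Qed.

(** Turning the data has the same effect on the error as turning the normal
   backwards, and unit normals remain so. *)
Lemma D_line_rotation : rotation_invariant (@D_line R n).
Proof.
move=> x y L phi /D_lineP[a [b [c [ab minc ->]]]]; apply/D_lineP.
have cs := cos2Dsin2 phi.
have E a' b' c' : normal_error (rotate_x phi x y) (rotate_y phi x y) a' b' c' =
    normal_error x y (a' * cos phi - b' * sin phi)
      (a' * sin phi + b' * cos phi) c'.
  by congr (_ * _); apply: eq_bigr => i _; rewrite !mxE; ring.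
have N a' b' : (a' * cos phi - b' * sin phi) ^+ 2 +
    (a' * sin phi + b' * cos phi) ^+ 2 = a' ^+ 2 + b' ^+ 2.
  transitivity ((a' ^+ 2 + b' ^+ 2) * (cos phi ^+ 2 + sin phi ^+ 2)).
    by ring.
  by rewrite cs mulr1.
exists (a * cos phi + b * sin phi), (b * cos phi - a * sin phi), c; split.
- transitivity ((a ^+ 2 + b ^+ 2) * (cos phi ^+ 2 + sin phi ^+ 2)).
    by ring.
  by rewrite cs mulr1.
- move=> a' b' c' ab'; rewrite !E.
  have -> : (a * cos phi + b * sin phi) * cos phi -
      (b * cos phi - a * sin phi) * sin phi = a.
    transitivity (a * (cos phi ^+ 2 + sin phi ^+ 2)); first by ring.
    by rewrite cs mulr1.
  have -> : (a * cos phi + b * sin phi) * sin phi +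
      (b * cos phi - a * sin phi) * cos phi = b.
    transitivity (b * (cos phi ^+ 2 + sin phi ^+ 2)); first by ring.
    by rewrite cs mulr1.
  by apply: minc; rewrite N.
- rewrite image_rotation; apply/seteqP.
  by split=> p /= <-; rewrite /rotation /= cosN sinN; ring.
Qed.

Lemma is_line_unit_normal L : is_line L -> exists a b c,
  a ^+ 2 + b ^+ 2 = 1 /\ L = [set p | p.1 * a - p.2 * b = c].
Proof.
move=> [a [b [c [ab ->]]]].
have r2_gt0 : 0 < a ^+ 2 + b ^+ 2.
  rewrite lt_def addr_ge0 ?sqr_ge0// andbT paddr_eq0 ?sqr_ge0// !sqrf_eq0.
  by apply: contra_notN ab => /andP[/eqP-> /eqP->].
set r := Num.sqrt (a ^+ 2 + b ^+ 2).
have r_neq0 : r != 0 by rewrite gt_eqF// sqrtr_gt0.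
have r2 : r ^+ 2 = a ^+ 2 + b ^+ 2 by rewrite sqr_sqrtr// ltW.
exists (a / r), (- (b / r)), (c / r); split.
  by rewrite sqrrN !exprMn -mulrDl -r2 -exprMn divff// expr1n.
apply/seteqP; split=> p /= h; first by rewrite -h; field.
by apply: (mulIf (invr_neq0 r_neq0)); rewrite -h; ring.
Qed.

Lemma D_line_collinear x y L : (0 < n)%N ->
  is_line L -> points_on x y L -> D_line x y L.
Proof.
move=> n0 /is_line_unit_normal[a [b [c [ab eL]]]] xyL; apply/D_lineP.
exists a, b, c; split=> // a' b' c' _.
have /eqP -> : normal_error x y a b c == 0.
  by apply/normal_error_eq0 => // i; have := xyL i; rewrite eL.
exact: normal_error_ge0.
Qed.

(** The normal of a line containing the data is in the kernel of their
   covariance matrix. *)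
Lemma collinear_cov x y a b c : (0 < n)%N ->
  (forall i, x ord0 i * a - y ord0 i * b = c) ->
  var x * a = cov x y * b /\ cov x y * a = var y * b.
Proof.
move=> n0 h.
have e : a *: x + (- b) *: y = const_mx c.
  by apply/rowP => i; rewrite !mxE -(h i); ring.
have := cov_constl n0 c x; have := cov_constl n0 c y.
by rewrite -e !covDl !covZl (covC y x) -!/(var _) => h1 h2; split; lra.
Qed.

(** Two unit normals in the kernel of a nonzero covariance matrix are
   proportional, hence opposite or equal. *)
Lemma D_line_collinear_unique x y L L' : (0 < n)%N ->
  is_line L -> points_on x y L -> ~ (var x = var y /\ cov x y = 0) ->
  D_line x y L' -> L' = L.
Proof.
move=> n0 /is_line_unit_normal[a [b [c [ab eL]]]] xyL nondeg.
move=> /D_lineP[a' [b' [c' [ab' minc eL']]]].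
have h i : x ord0 i * a - y ord0 i * b = c by have := xyL i; rewrite eL.
have err0 : normal_error x y a b c = 0 by apply/eqP/normal_error_eq0.
have h' i : x ord0 i * a' - y ord0 i * b' = c'.
  move: i; apply/normal_error_eq0 => //.
  by rewrite eq_le normal_error_ge0 -err0 minc.
have [k1 k2] := collinear_cov n0 h; have [k1' k2'] := collinear_cov n0 h'.
have det0 : a * b' = a' * b.
  apply: contra_notP nondeg => /eqP; rewrite -subr_eq0 => det.
  have vx : var x * (a * b' - a' * b) = 0.
    transitivity (var x * a * b' - var x * a' * b); first by ring.
    by rewrite k1 k1'; ring.
  have cxy : cov x y * (a * b' - a' * b) = 0.
    transitivity (cov x y * a * b' - cov x y * a' * b); first by ring.
    by rewrite k2 k2'; ring.
  have vy : var y * (a * b' - a' * b) = 0.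
    transitivity (a * (var y * b') - a' * (var y * b)); first by ring.
    by rewrite -k2 -k2'; ring.
  move: vx cxy vy => /eqP + /eqP + /eqP; rewrite !mulf_eq0 (negPf det) !orbF.
  by move=> /eqP-> /eqP-> /eqP->.
(* The sign relating both normals is their inner product. *)
set e := a * a' + b * b'.
have ea : e * a = a'.
  transitivity (a' * (a ^+ 2) + b * (a * b')); first by rewrite /e; ring.
  rewrite det0; transitivity (a' * (a ^+ 2 + b ^+ 2)); first by ring.
  by rewrite ab mulr1.
have eb : e * b = b'.
  transitivity (b' * (b ^+ 2) + a * (a' * b)); first by rewrite /e; ring.
  rewrite -det0; transitivity (b' * (a ^+ 2 + b ^+ 2)); first by ring.
  by rewrite ab mulr1.
have ec : e * c = c'.
  by rewrite -(h (Ordinal n0)) -(h' (Ordinal n0)) -ea -eb; ring.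
have e_neq0 : e != 0.
  apply: contra_eqN ab' => /eqP e0.
  by rewrite -ea -eb e0 !mul0r expr0n addr0 eq_sym oner_eq0.
rewrite eL eL' -ea -eb -ec; apply/seteqP; split=> p /= hp.
  by apply: (mulfI e_neq0); rewrite -hp; ring.
by rewrite -hp; ring.
Qed.

End Orthogonal.

(** * The three regression methods *)

Theorem proposition4p1 (R : realType) (n : nat) (hn : (2 <= n)%N) :
  (* (a) *)
  [/\ translation_invariant (@Y_line R n),
      translation_invariant (@X_line R n) &
      translation_invariant (@D_line R n)] /\
  (* (b) *)
  (forall (x y : 'rV[R]_n) (L : set (R * R)),
    is_line L -> points_on x y L ->
    [/\ ~ vertical L -> var x != 0 ->
          Y_line x y L /\ (forall L', Y_line x y L' -> L' = L),
        ~ horizontal L -> var y != 0 ->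
          X_line x y L /\ (forall L', X_line x y L' -> L' = L) &
        D_line x y L /\
          (~ (var x = var y /\ cov x y = 0) ->
           forall L', D_line x y L' -> L' = L)]) /\
  (* (c) *)
  [/\ rotation_invariant (@D_line R n),
      ~ rotation_invariant (@Y_line R n),
      ~ rotation_invariant (@X_line R n) &
      (* for n = 2 invariance fails only because the rotated data may have no
         regression line; for n >= 3 it fails even where both lines exist *)
      (3 <= n)%N ->
        ~ rotation_invariant_where_defined (@Y_line R n) /\
        ~ rotation_invariant_where_defined (@X_line R n)].
Proof.
have n0 : (0 < n)%N by exact: ltnW.
split; last split.
- split; [exact: Y_line_translation|exact: X_line_translation|].
  exact: D_line_translation.
- move=> x y L lineL xyL; split=> [nvert vx|nhor vy|].
  + have Yl := Y_line_collinear n0 lineL xyL nvert vx.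
    by split=> // L'; exact: Y_line_unique.
  + have Xl := X_line_collinear n0 lineL xyL nhor vy.
    by split=> // L'; exact: X_line_unique.
  + split; first exact: D_line_collinear.
    by move=> nondeg L'; exact: D_line_collinear_unique.
- have notY := @Y_line_not_rotation_invariant R n hn.
  split=> //; first exact: D_line_rotation.
    by move=> /X_to_Y_rotation_invariant.
  move=> /(@Y_line_not_rotation_invariant_where_defined R) notY'.
  by split=> // /X_to_Y_rotation_invariant_where_defined.
Qed.
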